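(* Let $\varepsilon>0$, let $d'$ be a distance on $\mathbb{S}^1\times\,]0,\varepsilon[$, and denote by $E'$ the resulting metric space. For every $h\in\,]0,\varepsilon[$ define $$\Delta(h):=\sup_{z_1,z_2\le h}\ \sup_{\theta_1,\theta_2\in\mathbb{S}^1}\left|d'[(\theta_1,z_1),(\theta_2,z_2)]-d[(\theta_1,z_1),(\theta_2,z_2)]\right|,$$ where $z_1,z_2$ range over $]0,h]$ and $d$ denotes the product distance on the cylinder. Set $$\delta_{E'}:=\sup\left\{\delta>0:\ \Delta(h)=O(h^\delta)\ \text{as } h\to0^+\right\}.$$ If $\delta_{E'}$ is finite, then the fractional index of $E'$ satisfies $$\beta_{E'}\le\frac{3}{\delta_{E'}+1},$$ and if $\delta_{E'}=+\infty$, then $$\beta_{E'}=0 .$$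
   Context: $]a,b[$ denotes an open interval. $\mathbb{S}^1$ is the circle of length $2\pi$ with angular coordinate $\theta\in[0,2\pi[$ and geodesic distance $d_{\mathbb{S}^1}(\theta_1,\theta_2)=\min(|\theta_1-\theta_2|,2\pi-|\theta_1-\theta_2|)$. The product distance on the cylinder is $d((\theta_1,z_1),(\theta_2,z_2))=\left(d_{\mathbb{S}^1}(\theta_1,\theta_2)^2+|z_1-z_2|^2\right)^{1/2}$. Convention: $\sup\emptyset=-\infty$, so that if $\Delta(h)=O(h^\delta)$ holds for no $\delta>0$, then $\delta_{E'}=-\infty$ is not finite and nothing is claimed. A symmetric function $f:S\times S\to\mathbb{R}$ on a set $S$ is a negative definite kernel if for every $n$, every $x_1,\dots,x_n\in S$ and every $c_1,\dots,c_n\in\mathbb{R}$ with $\sum_{i=1}^n c_i=0$, one has $\sum_{i,j=1}^n c_ic_jf(x_i,x_j)\le 0$. The fractional index of a metric space $(E,d_E)$ is the number $\beta_E\in[0,+\infty]$ (known to exist) such that for every $H>0$, the function $d_E^{2H}$ is a negative definite kernel if and only if $2H\le\beta_E$. *)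

(* Defs.v *)
(* MathComp / MathComp-Analysis *)
From HB Require Import structures.
From mathcomp Require Import all_boot all_order all_algebra.
From mathcomp Require Import all_classical all_reals all_analysis.

Set Implicit Arguments.
Unset Strict Implicit.
Unset Printing Implicit Defensive.

Import Order.TTheory GRing.Theory Num.Theory.
Import numFieldNormedType.Exports.

Local Open Scope classical_set_scope.
Local Open Scope ring_scope.

(* A metric space is a set S : set T together with a function d that is a
   distance on S; the values of d outside S x S are irrelevant. *)
Definition distance_on (R : realType) (T : Type) (S : set T)
    (d : T -> T -> R) : Prop :=
  [/\ forall x y, S x -> S y -> 0 <= d x y,
      forall x y, S x -> S y -> (d x y = 0 <-> x = y),
      forall x y, S x -> S y -> d x y = d y x &
      forall x y z, S x -> S y -> S z -> d x z <= d x y + d y z].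

Definition negative_definite_kernel (R : realType) (T : Type) (S : set T)
    (f : T -> T -> R) : Prop :=
  (forall x y, S x -> S y -> f x y = f y x) /\
  (forall (n : nat) (x : 'I_n -> T) (c : 'I_n -> R),
     (forall i, S (x i)) -> \sum_(i < n) c i = 0 ->
     \sum_(i < n) \sum_(j < n) c i * c j * f (x i) (x j) <= 0).

(* There is at most one such beta, and Schoenberg's theorem provides one. *)
Definition is_fractional_index (R : realType) (T : Type) (S : set T)
    (d : T -> T -> R) (beta : \bar R) : Prop :=
  (0 <= beta)%E /\
  forall H : R, 0 < H ->
    (negative_definite_kernel S (fun x y => d x y `^ (2 * H)) <->
     ((2 * H)%:E <= beta)%E).

(* The circle of length 2 pi, through its angular coordinate. *)
Definition circle (R : realType) : set R := `[0, 2 * pi[.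

Definition circle_dist (R : realType) (t1 t2 : R) : R :=
  Num.min `|t1 - t2| (2 * pi - `|t1 - t2|).

Definition cylinder (R : realType) (eps : R) : set (R * R) :=
  @circle R `*` `]0, eps[.

Definition cylinder_dist (R : realType) (p q : R * R) : R :=
  Num.sqrt (circle_dist p.1 q.1 ^+ 2 + `|p.2 - q.2| ^+ 2).

(* Extended-real valued, since d' need not be bounded. *)
Definition Delta (R : realType) (d' : R * R -> R * R -> R) (h : R) : \bar R :=
  ereal_sup [set
    ereal_sup [set
      `|d' (t1, z1) (t2, z2) - cylinder_dist (t1, z1) (t2, z2)|%:E
      | t1 in @circle R & t2 in @circle R]
    | z1 in `]0, h] & z2 in `]0, h]].

(* Delta(h) = O(h^delta) as h -> 0+; this entails that Delta(h) is finite for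
   small h. The library's bigO does not apply to functions valued in \bar R. *)
Definition Delta_bigO (R : realType) (d' : R * R -> R * R -> R)
    (delta : R) : Prop :=
  exists C : R, \forall h \near 0^'+, (Delta d' h <= (C * h `^ delta)%:E)%E.

(* ereal_sup set0 = -oo. *)
Definition delta_exponent (R : realType) (d' : R * R -> R * R -> R) : \bar R :=
  ereal_sup [set delta%:E | delta in
    [set delta : R | 0 < delta /\ Delta_bigO d' delta]].

(* Main.v *)
Require Import Defs.
From HB Require Import structures.
From mathcomp Require Import all_boot all_order all_algebra.
From mathcomp Require Import all_classical all_reals all_analysis.
From mathcomp Require Import zify ring lra.

(** The obstruction comes from the kink of the geodesic distance of the circle
    at pairs of antipodal points. On arbitrarily thin cylinders it makes the
    quadratic form of d ^ b positive for suitable coefficients, by a margin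
    that remains when d is replaced by a distance d' close enough to it at low
    heights.

    Let b be an exponent for which d' ^ b is negative definite, let n = 2 p and
    s = pi / n. The test points form a grid of 2 n equidistant angles and M
    heights, with the same spacing s in both directions, and the coefficients
    alternate in sign along each circle. For the cylinder distance the form is
    2 n s ^ b times the sum over pairs of heights (l, l') of
    [axial_sum b p |l - l'|] ([cylinder_form_grid]), where [axial_sum b p w]
    adds up the second differences of k |-> (k ^ 2 + w ^ 2) ^ (b / 2) at the
    even integers k < n. Such a sum is half the slope at the right end minus
    half the slope at the left end, up to an error governed by third
    differences ([sum_second_difference]). The right end is the antipodal
    point, where the slope has order n ^ (b - 1). The profile is even in k, so
    that the slope at the left end is small, and it is smooth away from
    k = w = 0, so that the third differences decay like the power b - 3 of the
    distance to that point, which is summable over the plane. Hence for b < 1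
    the sum over pairs of heights is at least c n ^ (b - 1) M ^ 2 - K M
    ([sum_axial_sum_ge]): the kink contributes for every pair of heights, the
    singularity on the diagonal only once per height.

    With M of order n ^ (1 - b) the first term wins, and the grid has height
    M s of order n ^ (- b) only. At that height Delta is O(n ^ (- b delta)),
    and the passage from d to d' changes the form by a negligible amount as
    soon as n ^ (- b delta) is much smaller than n ^ (b - 3). This excludes
    b (1 + delta) > 3 when b < 1 ([index_lt1_le]). Exponents b > 1 are
    excluded by four equidistant points on one low circle
    ([index_gt1_false]). Since every exponent up to beta is negative definite,
    beta <= 3 / (delta + 1) for each admissible delta ([fractional_index_le]),
    and it remains to let delta tend to its supremum. *)

Set Implicit Arguments.
Unset Strict Implicit.
Unset Printing Implicit Defensive.

Import Order.TTheory GRing.Theory Num.Theory.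
Import numFieldNormedType.Exports.

Local Open Scope classical_set_scope.
Local Open Scope ring_scope.

(** * Power functions *)

(** The inequality exp y >= 1 + y at y = a ln x, and then at y = - ln x. It
    gives the lower bounds on increments of powers below without any
    derivative. *)
Lemma powR_ge1BV (R : realType) (x a : R) :
  0 < x -> 0 <= a -> a * (1 - x^-1) <= x `^ a - 1.
Proof.
move=> x0 a0; have xV0 : 0 < x^-1 by rewrite invr_gt0.
have lnx : 1 - x^-1 <= ln x.
  have := expR_ge1Dx (ln x^-1); rewrite lnK ?posrE// lnV ?posrE//; lra.
rewrite /powR gt_eqF// lerBrDl (le_trans _ (expR_ge1Dx _))// lerD2l.
exact: ler_wpM2l.
Qed.

(** By homogeneity this reduces to |t ^ b - 1| <= |t - 1| for t = x / y, which
    holds because t ^ b lies between 1 and t. Only one of the two points has to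
    be at least s, as in the comparison of an unknown distance with a distance
    of the cylinder. *)
Lemma powR_lipschitz (R : realType) (s x y b : R) :
  0 < s -> s <= y -> 0 <= x -> 0 < b <= 1 ->
  `|x `^ b - y `^ b| <= s `^ (b - 1) * `|x - y|.
Proof.
move=> s0 sy x0 /andP[b0 b1].
have y0 : 0 < y by exact: lt_le_trans s0 sy.
have yy : y `^ (b - 1) <= s `^ (b - 1).
  rewrite -(opprB 1 b) !powRN lef_pV2 ?posrE ?powR_gt0//.
  by apply: ge0_ler_powR; rewrite ?nnegrE ?subr_ge0 ?(ltW s0) ?(ltW y0).
apply: (@le_trans _ _ (y `^ (b - 1) * `|x - y|)); last exact: ler_wpM2r.
set t := x / y; have t0 : 0 <= t by rewrite divr_ge0// ltW.
have xE : x = y * t by rewrite /t mulrC divfK ?gt_eqF.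
have yb : y `^ b = y `^ (b - 1) * y by rewrite mulrC mulr_powRB1// ltW.
have tb : `|t `^ b - 1| <= `|t - 1|.
  have [t1|t1] := leP 1 t.
    have ? : t `^ b <= t by exact: ler1_powR.
    have ? : 1 <= t `^ b by rewrite -(powRr0 t) ler_powR// ltW.
    by rewrite !ger0_norm; lra.
  have [->|tn0] := eqVneq t 0; first by rewrite powR0 ?gt_eqF.
  have tp : 0 < t by rewrite lt_neqAle eq_sym tn0.
  have ? : t <= t `^ b by apply: ger1_powR => //; rewrite tp ltW.
  have ? : t `^ b <= 1 by rewrite -(powRr0 t) ger_powR ?tp ?ltW.
  by rewrite !ler0_norm; lra.
have -> : x `^ b - y `^ b = y `^ (b - 1) * y * (t `^ b - 1).
  by rewrite -yb xE powRM ?(ltW y0)// mulrBr mulr1.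
have -> : x - y = y * (t - 1) by rewrite mulrBr mulr1 -xE.
rewrite !normrM (ger0_norm (powR_ge0 _ _)) mulrA.
by rewrite ler_wpM2l// mulr_ge0// powR_ge0.
Qed.

(** A telescoping bound: (q - 1) (j + 1) ^ (- q) is at most the decrement of
    y ^ (1 - q) between j and j + 1. *)
Lemma sum_powRN_le (R : realType) (q : R) (p : nat) :
  1 < q -> \sum_(j < p) j.+1%:R `^ (- q) <= 1 + (q - 1)^-1.
Proof.
move=> q1; set a := q - 1; have a0 : 0 < a by rewrite subr_gt0.
case: p => [|p]; first by rewrite big_ord0 addr_ge0// invr_ge0 ltW.
suff : \sum_(j < p.+1) j.+1%:R `^ (- q)
    <= 1 + a^-1 * (1 - p.+1%:R `^ (- a)) :> R.
  move=> /le_trans; apply; rewrite lerD2l ger_pMr ?invr_gt0// gerBl.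
elim: p => [|p IH].
  by rewrite big_ord_recr big_ord0 /= !powR1 subrr mulr0 addr0 add0r.
rewrite big_ord_recr /=; apply: le_trans (lerD IH (lexx _)) _.
rewrite -addrA lerD2l -lerBrDl -mulrBr ler_pdivlMl//.
have P1 : 0 < p.+1%:R :> R by rewrite ltr0n.
have P2 : 0 < p.+2%:R :> R by rewrite ltr0n.
suff: a * p.+2%:R `^ (- q) <= p.+1%:R `^ (- a) - p.+2%:R `^ (- a) :> R by lra.
set x : R := p.+2%:R / p.+1%:R; have x0 : 0 < x by rewrite divr_gt0.
have E : p.+1%:R `^ (- a) = p.+2%:R `^ (- a) * x `^ a :> R.
  rewrite !powRN /x powRM ?(ltW P2)// ?invr_ge0 ?(ltW P1)//.
  rewrite mulrA mulVf ?mul1r ?gt_eqF ?powR_gt0//.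
  by rewrite -(powR_inv1 (ltW P1)) -powRrM mulN1r powRN.
have qE : - q = - a + -1 by rewrite /a; ring.
rewrite E -[X in _ <= _ - X]mulr1 -mulrBr qE.
rewrite powRD; last by rewrite (gt_eqF P2)// implybT.
rewrite powR_inv1 ?(ltW P2)// mulrCA ler_wpM2l ?powR_ge0//.
apply: le_trans (powR_ge1BV x0 (ltW a0)); rewrite ler_pM2l//.
rewrite /x invf_div -(natr1 p.+1); move: P1; move: p.+1%:R => y y0.
rewrite [leRHS](_ : _ = (y + 1)^-1)//; field; apply: lt0r_neq0; lra.
Qed.

(** * Finite differences of the profile *)

Lemma unit_step_le (R : realType) (f g : R -> R) (x C : R) :
  (forall y, x <= y <= x + 1 -> is_derive y 1 f (g y)) ->
  (forall y, x <= y <= x + 1 -> `|g y| <= C) -> `|f (x + 1) - f x| <= C.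
Proof.
move=> fg gC; have x1 : x <= x + 1 by rewrite lerDl.
have [||y] := @MVT_segment R f g x (x + 1) x1.
- by move=> y; rewrite in_itv/= => /andP[xy yx]; apply: fg; rewrite !ltW.
- apply: derivable_within_continuous => y; rewrite in_itv/= => xy.
  by have [] := fg _ xy.
- by rewrite in_itv/= addrAC subrr add0r mulr1 => xy ->; exact: gC.
Qed.

(** A third difference is a unit step of a second difference, whose derivative
    is a difference of unit steps: use the mean value theorem three times. *)
Lemma third_difference_le (R : realType) (f0 f1 f2 f3 : R -> R) (x C : R) :
  (forall y, x <= y <= x + 3 -> is_derive y 1 f0 (f1 y)) ->
  (forall y, x <= y <= x + 3 -> is_derive y 1 f1 (f2 y)) ->
  (forall y, x <= y <= x + 3 -> is_derive y 1 f2 (f3 y)) ->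
  (forall y, x <= y <= x + 3 -> `|f3 y| <= C) ->
  `|f0 (x + 3) - 3 * f0 (x + 2) + 3 * f0 (x + 1) - f0 x| <= C.
Proof.
move=> f01 f12 f23 f3C.
have shift (f g : R -> R) (a y : R) : is_derive (y + a) 1 f (g (y + a)) ->
    is_derive y 1 (fun z => f (z + a)) (g (y + a)).
  move=> fg; have da : is_derive y 1 (fun z => z + a) (1 : R).
    have := is_deriveD (is_derive_id y (1 : R)) (is_derive_cst a y 1).
    by move=> /is_derive_eq; apply; rewrite addr0.
  have := @is_derive1_comp R f (fun z => z + a) y _ _ fg da.
  by move=> /is_derive_eq; apply; rewrite mulr1.
pose F y := f0 (y + 2) - 2 * f0 (y + 1) + f0 y.
pose G y := f1 (y + 2) - 2 * f1 (y + 1) + f1 y.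
pose F' y := f1 (y + 1) - f1 y.
pose G' y := f2 (y + 1) - f2 y.
have bound2 y : x <= y <= x + 1 -> `|G y| <= C.
  move=> /andP[xy yx]; have -> : G y = F' (y + 1) - F' y.
    have yE : y + 1 + 1 = y + 2 by ring.
    by rewrite /G /F' yE; ring.
  apply: (@unit_step_le _ _ G') => z /andP[yz zy].
    apply: is_deriveB; last by apply: f12; lra.
    by apply: shift; apply: f12; lra.
  by apply: (@unit_step_le _ _ f3) => t /andP[zt tz]; [apply: f23|apply: f3C];
    lra.
have -> : f0 (x + 3) - 3 * f0 (x + 2) + 3 * f0 (x + 1) - f0 x
          = F (x + 1) - F x.
  have -> : x + 3 = x + 1 + 2 by ring.
  have x2E : x + 2 = x + 1 + 1 by ring.
  by rewrite /F x2E; ring.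
apply: (@unit_step_le _ _ G) => // y /andP[xy yx].
apply: is_deriveD; last by apply: f01; lra.
apply: is_deriveB; first by apply: shift; apply: f01; lra.
by apply: is_deriveZ; apply: shift; apply: f01; lra.
Qed.

(** With spacing 1, the b-th power of the distance between two points at
    angular offset x and height offset w. *)
Definition profile (R : realType) (b w x : R) : R :=
  (x ^+ 2 + w ^+ 2) `^ (b / 2).

Lemma is_derive_powR_sqrD (R : realType) (c w x : R) :
  0 < x ^+ 2 + w ^+ 2 ->
  is_derive x 1 (fun y => (y ^+ 2 + w ^+ 2) `^ c)
    (2 * c * x * (x ^+ 2 + w ^+ 2) `^ (c - 1)).
Proof.
move=> u0.
have du : is_derive x 1 (fun y : R => y ^+ 2 + w ^+ 2) (2 * x).
  by apply: is_derive_eq; rewrite addr0 /GRing.scale /= mulr1; ring.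
have dp := @is_derive1_powR R c _ u0.
have := @is_derive1_comp R (fun y => y `^ c) (fun y : R => y ^+ 2 + w ^+ 2)
  x _ _ dp du.
by move=> /is_derive_eq; apply; ring.
Qed.

(** The third derivative of the profile is bounded by 3 times the power b - 3
    of the distance sqrt (x ^ 2 + w ^ 2) to the origin. Since x ^ 2 + w ^ 2
    dominates the product of j + 1 and w + 1, this is bounded by a product of
    two summable sequences, which separates the two summations. *)
Lemma third_difference_profile_le (R : realType) (b : R) (j w : nat) :
  0 < b < 1 ->
  `|profile b w%:R (j.*2%:R + 3) - 3 * profile b w%:R (j.*2%:R + 2)
    + 3 * profile b w%:R (j.*2%:R + 1) - profile b w%:R j.*2%:R|
  <= 12 * (j.+1%:R `^ (- ((3 - b) / 2)) * w.+1%:R `^ (- ((3 - b) / 2))).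
Proof.
move=> /andP[b0 b1]; set q := (3 - b) / 2.
(* Crude bounds suffice at the origin, where the profile is not smooth. *)
have [/andP[/eqP -> /eqP ->]|jw] := boolP ((j == 0%N) && (w == 0%N)).
  rewrite double0 !powR1 !mulr1 !add0r /profile expr0n /= !addr0 expr1n powR1.
  rewrite powR0 ?mulf_neq0 ?gt_eqF// ?invr_gt0//.
  have sq (x : R) : 0 <= x -> (x ^+ 2) `^ (b / 2) = x `^ b.
    by move=> x0; rewrite -powR_mulrn// -powRrM mulrCA divff ?mulr1.
  rewrite !sq//.
  have ? : 3 `^ b <= 3 :> R by apply: ler1_powR; lra.
  have ? : 2 `^ b <= 2 :> R by apply: ler1_powR; lra.
  have ? : 1 <= 3 `^ b :> R by rewrite -[leLHS](powRr0 3) ler_powR; lra.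
  have ? : 1 <= 2 `^ b :> R by rewrite -[leLHS](powRr0 2) ler_powR; lra.
  by rewrite ler_norml; lra.
pose u (y : R) := y ^+ 2 + w%:R ^+ 2.
have low y : j.*2%:R <= y -> j.+1%:R * w.+1%:R / 2 <= u y.
  move=> jy; apply: (@le_trans _ _ ((j.*2 ^ 2 + w ^ 2)%N%:R)).
    rewrite ler_pdivrMr// -!natrM ler_nat.
    by case: j {jy} jw => [|j]; case: w {u} => [|w]// _; nia.
  by rewrite natrD !natrX lerD2r lerXn2r// nnegrE// (le_trans _ jy).
have low0 : 0 < j.+1%:R * w.+1%:R / 2 :> R.
  by rewrite divr_gt0// mulr_gt0// ltr0n.
pose c := b / 2.
pose f1 (y : R) := b * (y * u y `^ (c - 1)).
pose f2 (y : R) :=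
  b * (u y `^ (c - 1) + (b - 2) * (y ^+ 2 * u y `^ (c - 1 - 1))).
pose f3 (y : R) := b * (b - 2) * (3 * (y * u y `^ (c - 1 - 1))
  + (b - 4) * (y ^+ 3 * u y `^ (c - 1 - 1 - 1))).
apply: (@third_difference_le _ (profile b w%:R) f1 f2 f3).
- move=> y /andP[jy _]; have u0 := lt_le_trans low0 (low _ jy).
  have := is_derive_powR_sqrD (b / 2) u0.
  by move=> /is_derive_eq; apply; rewrite /f1 /c /u; field.
- move=> y /andP[jy _]; have u0 := lt_le_trans low0 (low _ jy).
  have d1 := is_derive_powR_sqrD (c - 1) u0.
  have := is_deriveZ b (is_deriveM (is_derive_id y (1 : R)) d1).
  move=> /is_derive_eq; apply; rewrite /GRing.scale /= /f2 /c /u.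
  by field.
- move=> y /andP[jy _]; have u0 := lt_le_trans low0 (low _ jy).
  have d1 := is_derive_powR_sqrD (c - 1) u0.
  have d2 := is_derive_powR_sqrD (c - 1 - 1) u0.
  have dX : is_derive y 1 (fun z : R => z ^+ 2) (2 * y).
    by apply: is_derive_eq; rewrite /GRing.scale /= mulr1; ring.
  have := is_deriveZ b (is_deriveD d1 (is_deriveZ (b - 2) (is_deriveM dX d2))).
  move=> /is_derive_eq; apply; rewrite /GRing.scale /= /f3 /c /u.
  by field.
move=> y /andP[jy _]; have := low _ jy; set v := u y => lv.
have v0 := lt_le_trans low0 lv.
have y0 : 0 <= y by apply: le_trans jy.
(* The third derivative is b (b - 2) (3 t - (4 - b) t ^ 3) v ^ (- q). *)
set t := y / Num.sqrt v.
have sv0 : 0 < Num.sqrt v by rewrite sqrtr_gt0.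
have t0 : 0 <= t by rewrite divr_ge0// ltW.
have t1 : t <= 1.
  rewrite ler_pdivrMr// mul1r -[leLHS]ger0_norm// -sqrtr_sqr.
  by rewrite ler_wsqrtr// lerDl sqr_ge0.
have p2 : y * v `^ (c - 1 - 1) = t * v `^ (- q).
  have -> : c - 1 - 1 = - q - 2^-1 by rewrite /c /q; field.
  by rewrite powRB ?(gt_eqF v0) ?implybT// powR12_sqrt ?(ltW v0)// mulrCA mulrC.
have p3 : y ^+ 3 * v `^ (c - 1 - 1 - 1) = t ^+ 3 * v `^ (- q).
  rewrite powRB ?(gt_eqF v0) ?implybT// powRr1 ?(ltW v0)//.
  have -> : y ^+ 3 * (v `^ (c - 1 - 1) / v) =
      (y * v `^ (c - 1 - 1)) * (y ^+ 2 / v).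
    by rewrite exprS; ring.
  have tt : t ^+ 2 = y ^+ 2 / v by rewrite exprMn exprVn sqr_sqrtr// ltW.
  by rewrite p2 (exprS t) tt; ring.
rewrite /f3 -/v p2 p3.
have -> : b * (b - 2) * (3 * (t * v `^ (- q)) + (b - 4) * (t ^+ 3 * v `^ (- q)))
  = b * (b - 2) * (3 * t - (4 - b) * t ^+ 3) * v `^ (- q) by ring.
rewrite normrM (ger0_norm (powR_ge0 _ _)).
have t3 : 0 <= t ^+ 3 <= t.
  by rewrite exprn_ge0//= exprS ler_piMr// exprn_ile1.
have B1 : `|b * (b - 2)| <= 1 by rewrite ler_norml; nra.
have B2 : `|3 * t - (4 - b) * t ^+ 3| <= 3 by rewrite ler_norml; nra.
have B3 : `|b * (b - 2) * (3 * t - (4 - b) * t ^+ 3)| <= 3.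
  by rewrite normrM -[leRHS]mul1r ler_pM.
apply: (le_trans (ler_wpM2r (powR_ge0 _ _) B3)).
have q0 : 0 <= q by rewrite /q; lra.
have vq : v `^ (- q) <= (j.+1%:R * w.+1%:R / 2) `^ (- q).
  by rewrite !powRN lef_pV2 ?posrE ?powR_gt0// ge0_ler_powR ?nnegrE// ltW.
apply: (le_trans (ler_wpM2l _ vq)) => //.
rewrite powRM ?invr_ge0// powRM//.
have h4 : 2^-1 `^ (- q) <= 4 :> R.
  rewrite -powR_inv1// -powRrM mulN1r opprK.
  have -> : 4 = 2 `^ 2 :> R by rewrite powR_mulrn//; lra.
  by apply: ler_powR; rewrite /q; lra.
have jw0 := mulr_ge0 (powR_ge0 j.+1%:R (- q)) (powR_ge0 w.+1%:R (- q)).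
by have := ler_wpM2l jw0 h4; lra.
Qed.

(** * Alternating sums along a circle *)

Definition second_difference (R : realType) (f : nat -> R) (k : nat) : R :=
  f k - 2 * f k.+1 + f k.+2.

(** The sum over the even integers is half of the full telescoping sum, up to
    the differences between consecutive terms. *)
Lemma sum_second_difference (R : realType) (f : nat -> R) (p : nat) :
  \sum_(j < p) second_difference f j.*2 =
    2^-1 * ((f p.*2.+1 - f p.*2) - (f 1%N - f 0%N))
    - 2^-1 * \sum_(j < p)
        (f j.*2.+3 - 3 * f j.*2.+2 + 3 * f j.*2.+1 - f j.*2).
Proof.
elim: p => [|p IH]; first by rewrite !big_ord0 double0; ring.
by rewrite !big_ord_recr /= IH doubleS /second_difference; field.
Qed.

(** Both arcs from a point of the cycle to its antipode contribute the same
    values, so that each inner point of the arc is counted twice and the two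
    end points once; with alternating signs this is a sum of second
    differences. The number of points is a multiple of 4, so that antipodal
    points have equal signs. *)
Lemma alternating_cycle_sum (R : realType) (f : nat -> R) (p : nat) :
  \sum_(0 <= r < p.*2.*2) (-1) ^+ r * f (minn r (p.*2.*2 - r)) =
  \sum_(j < p) second_difference f j.*2.
Proof.
have -> : \sum_(0 <= r < p.*2.*2) (-1) ^+ r * f (minn r (p.*2.*2 - r)) =
    \sum_(0 <= r < p.*2) (-1) ^+ r * (f r - f r.+1).
  rewrite (big_cat_nat (n := p.*2))//=; last by lia.
  have -> : \sum_(p.*2 <= r < p.*2.*2) (-1) ^+ r * f (minn r (p.*2.*2 - r)) =
      \sum_(0 <= r < p.*2) (-1) ^+ r.+1 * f r.+1.
    rewrite big_nat_rev /= -{1}[p.*2]add0n big_addn.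
    have -> : (p.*2.*2 - p.*2)%N = p.*2 by lia.
    apply: eq_big_nat => r /andP[_ rp]; congr (_ * f _); last by lia.
    rewrite -signr_odd -[RHS]signr_odd; congr (_ ^+ nat_of_bool _); lia.
  rewrite -big_split /=; apply: eq_big_nat => r /andP[_ rp].
  have -> : minn r (p.*2.*2 - r) = r by lia.
  by rewrite exprS; ring.
elim: p => [|p IH]; first by rewrite big_geq// big_ord0.
rewrite doubleS !big_nat_recr//= IH big_ord_recr /= /second_difference.
by rewrite exprS -signr_odd odd_double; ring.
Qed.

(** The alternating sum of the profile over a circle at height offset w: the
    signed interaction between a point and all the points of that circle. *)
Definition axial_sum (R : realType) (b : R) (p w : nat) : R :=
  \sum_(j < p) second_difference (fun k => profile b w%:R k%:R) j.*2.

(** The left end of the arc: the profile is even, so that its first step is of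
    order w ^ (b - 2), which is also summable in w. *)
Lemma first_step_profile_le (R : realType) (b : R) (w : nat) :
  0 < b < 1 ->
  profile b w%:R 1 - profile b w%:R 0 <= 4 * w.+1%:R `^ (- ((3 - b) / 2)).
Proof.
move=> /andP[b0 b1]; rewrite /profile expr0n /= add0r expr1n.
case: w => [|w].
  rewrite expr0n /= addr0 powR0 ?mulf_neq0 ?gt_eqF// ?invr_gt0//.
  by rewrite !powR1; lra.
set q := (3 - b) / 2; set v : R := w.+1%:R ^+ 2.
have v0 : 0 < v by rewrite exprn_gt0// ltr0n.
have := @powR_lipschitz R v (1 + v) v (b / 2) v0 (lexx _).
rewrite addr_ge0 ?(ltW v0)// addrK normr1 mulr1 => /(_ isT).
have -> : 0 < b / 2 <= 1 by apply/andP; split; lra.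
move=> /(_ isT) /(le_trans (ler_norm _)) /le_trans; apply.
have -> : v `^ (b / 2 - 1) = w.+1%:R `^ (b - 2).
  rewrite /v -powR_mulrn// -powRrM; congr (_ `^ _); lra.
have w1 : 1 <= w.+1%:R :> R by rewrite ler1n.
apply: (@le_trans _ _ (w.+1%:R `^ (- q))).
  by apply: ler_powR; rewrite /q; lra.
have -> : 4 = 2^-1 `^ (- 2) :> R.
  by rewrite -powR_inv1// -powRrM mulrN mulN1r opprK powR_mulrn//; lra.
apply: (@le_trans _ _ (2^-1 `^ (- q) * w.+2%:R `^ (- q))).
  have w2 : 0 < 2^-1 * w.+2%:R :> R by rewrite mulr_gt0// ?invr_gt0 ltr0n.
  rewrite -powRM ?invr_ge0// !powRN lef_pV2 ?posrE ?powR_gt0//.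
  apply: ge0_ler_powR; rewrite ?nnegrE ?(ltW w2)//; first by rewrite /q; lra.
  by rewrite -(natr1 w.+1); lra.
rewrite ler_wpM2r ?powR_ge0//; apply: ger_powR; rewrite /q; lra.
Qed.

(** The right end of the arc: the slope of the profile at the antipode, where
    the kink of the geodesic distance lies. *)
Lemma last_step_profile_ge (R : realType) (b n w : R) :
  0 < b < 1 -> 1 <= n -> 0 <= w <= n ->
  b / 5 * n `^ (b - 1) <= profile b w (n + 1) - profile b w n.
Proof.
move=> /andP[b0 b1] n1 /andP[w0 wn]; rewrite /profile.
set u := n ^+ 2 + w ^+ 2.
(* As w <= n, the number u is of order n ^ 2. *)
have un : n ^+ 2 <= u by rewrite lerDl sqr_ge0.
have u2n : u <= 2 * n ^+ 2 by rewrite /u; nra.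
have u0 : 0 < u by apply: lt_le_trans un; nra.
have -> : (n + 1) ^+ 2 + w ^+ 2 = u + (2 * n + 1) by rewrite /u; ring.
set x := (u + (2 * n + 1)) / u.
have x0 : 0 < x by rewrite divr_gt0//; lra.
have -> : u + (2 * n + 1) = u * x by rewrite /x [RHS]mulrC divfK ?gt_eqF.
rewrite powRM ?(ltW u0) ?(ltW x0)// -[X in _ <= _ - X]mulr1 -mulrBr.
have b20 : 0 <= b / 2 by lra.
have := ler_wpM2l (powR_ge0 u (b / 2)) (powR_ge1BV x0 b20).
move=> /(le_trans _); apply.
have unb : n `^ b <= u `^ (b / 2).
  rewrite (_ : n `^ b = (n ^+ 2) `^ (b / 2)).
    apply: ge0_ler_powR; rewrite ?nnegrE ?sqr_ge0//; lra.
  rewrite -powR_mulrn ?(le_trans ler01)// -powRrM; congr (_ `^ _); lra.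
have xV : 2 / 5 / n <= 1 - x^-1.
  rewrite /x invf_div -[X in X - _](@divff _ (u + (2 * n + 1))); last by lra.
  rewrite -mulrBl ler_pdivrMr ?(lt_le_trans ltr01)// mulrAC ler_pdivlMr; nra.
have -> : b / 5 * n `^ (b - 1) = n `^ b * (b / 2 * (2 / 5 / n)).
  rewrite powRB ?powRr1 ?(le_trans ler01)//; first by field; lra.
  by rewrite (gt_eqF (lt_le_trans ltr01 n1)) implybT.
apply: ler_pM => //; first exact: powR_ge0.
  by rewrite !mulr_ge0 ?invr_ge0//; lra.
by apply: ler_wpM2l.
Qed.

Lemma axial_sum_ge (R : realType) (b : R) (p w : nat) :
  0 < b < 1 -> (0 < p)%N -> (w <= p.*2)%N ->
  b / 10 * p.*2%:R `^ (b - 1)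
    - (8 + 6 * ((3 - b) / 2 - 1)^-1) * w.+1%:R `^ (- ((3 - b) / 2))
  <= axial_sum b p w.
Proof.
move=> b01 p0 wp; rewrite /axial_sum sum_second_difference.
have first := first_step_profile_le w b01.
have last : b / 5 * p.*2%:R `^ (b - 1)
    <= profile b w%:R p.*2.+1%:R - profile b w%:R p.*2%:R :> R.
  rewrite -(natr1 p.*2); apply: last_step_profile_ge => //.
    by rewrite ler1n double_gt0.
  by rewrite ler0n ler_nat.
set q := (3 - b) / 2 in first *.
have q1 : 1 < q by rewrite /q; lra.
set E := w.+1%:R `^ (- q) in first *.
have E0 : 0 <= E by exact: powR_ge0.
set S := \sum_(j < p) _.
suff : S <= 12 * (E * (1 + (q - 1)^-1)) by move=> SE; lra.
apply: (@le_trans _ _ (\sum_(j < p) 12 * (j.+1%:R `^ (- q) * E))).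
  apply: ler_sum => j _; apply: le_trans (ler_norm _) _.
  have := third_difference_profile_le j w b01; rewrite -/q -/E.
  by rewrite -(natrD _ _ 3) -(natrD _ _ 2) -(natrD _ _ 1) !addnS addn0.
rewrite -mulr_sumr -mulr_suml ler_wpM2l// mulrC ler_wpM2l//.
exact: sum_powRN_le.
Qed.

(** * Grids on the cylinder *)

Definition nat_dist (k l : nat) : nat := maxn k l - minn k l.

Lemma normr_natB (R : realType) (k l : nat) :
  `|k%:R - l%:R| = (nat_dist k l)%:R :> R.
Proof.
wlog kl : k l / (k <= l)%N.
  move=> W; have [/W//|/ltnW/W] := leqP k l.
  by rewrite distrC => ->; rewrite /nat_dist maxnC minnC.
have -> : nat_dist k l = (l - k)%N by rewrite /nat_dist; lia.
by rewrite distrC natrB// ger0_norm// subr_ge0 ler_nat.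
Qed.

Lemma sum_periodic (V : zmodType) (F : nat -> V) (N m : nat) :
  (forall k, F (k + N)%N = F k) ->
  \sum_(0 <= r < N) F (m + r)%N = \sum_(0 <= r < N) F r.
Proof.
move=> FN; elim: m => [|m IH]; first by [].
rewrite -IH; apply: (addrI (F m)).
have := @big_nat_recr _ 0 (@GRing.add V) N 0 (fun r => F (m + r)%N) (leq0n N).
rewrite big_nat_recl//= FN addn0 [RHS]addrC => <-; congr (_ + _).
by apply: eq_bigr => r _; rewrite addSnnS.
Qed.

(** The kernel is invariant under rotations and the signs are multiplicative,
    so that each of the N rows has the same sum. *)
Lemma alternating_cycle_form (R : realType) (f : nat -> R) (N : nat) :
  (0 < N)%N -> ~~ odd N ->
  \sum_(k < N) \sum_(l < N) (-1) ^+ k * (-1) ^+ l *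
    f (minn (nat_dist k l) (N - nat_dist k l)) =
  N%:R * \sum_(0 <= r < N) (-1) ^+ r * f (minn r (N - r)).
Proof.
move=> N0 oN.
(* F extends row l to an N-periodic function of k, as N is even. *)
pose F l k := (-1) ^+ (k + l)%N *
  f (minn ((k + (N - l)) %% N) (N - (k + (N - l)) %% N)).
rewrite exchange_big /= mulr_natl.
rewrite -[X in _ *+ X]card_ord -sumr_const; apply: eq_bigr => l _.
have lN := ltn_ord l.
have -> : \sum_(k < N) (-1) ^+ k * (-1) ^+ l *
    f (minn (nat_dist k l) (N - nat_dist k l)) = \sum_(0 <= k < N) F l k.
  rewrite big_mkord; apply: eq_bigr => k _; have kN := ltn_ord k.
  rewrite -exprD /F; congr (_ * f _).
  have [kl|lk] := ltnP k l.
    by rewrite modn_small /nat_dist; lia.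
  have -> : (k + (N - l) = k - l + N)%N by lia.
  by rewrite modnDr modn_small /nat_dist; lia.
rewrite -(@sum_periodic _ _ _ l); last first.
  move=> k; rewrite /F addnAC [(k + N + (N - l))%N]addnAC modnDr exprD.
  by rewrite -(signr_odd _ N) (negPf oN) mulr1.
apply: eq_big_nat => r /andP[_ rN]; rewrite /F.
have -> : (l + r + (N - l) = r + N)%N by lia.
rewrite modnDr modn_small//; congr (_ * _).
by rewrite -signr_odd -[RHS]signr_odd; congr (_ ^+ nat_of_bool _); lia.
Qed.

Definition grid_step (R : realType) (p : nat) : R := pi / p.*2%:R.

Definition grid_point (R : realType) (p : nat) (z0 : R) (k l : nat) : R * R :=
  (k%:R * grid_step R p, z0 + l%:R * grid_step R p).

Lemma grid_step_gt0 (R : realType) (p : nat) : (0 < p)%N -> 0 < grid_step R p.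
Proof. by move=> p0; rewrite divr_gt0 ?pi_gt0// ltr0n double_gt0. Qed.

Lemma cylinder_dist_grid (R : realType) (p : nat) (z0 : R) (k k' l l' : nat) :
  (0 < p)%N -> (k < p.*2.*2)%N -> (k' < p.*2.*2)%N ->
  let e := minn (nat_dist k k') (p.*2.*2 - nat_dist k k') in
  cylinder_dist (grid_point p z0 k l) (grid_point p z0 k' l') =
    grid_step R p * Num.sqrt (e%:R ^+ 2 + (nat_dist l l')%:R ^+ 2).
Proof.
move=> p0 kN kN' e; have s0 := @grid_step_gt0 R p p0.
rewrite /cylinder_dist /circle_dist /=; set s := grid_step R p in s0 *.
have -> : 2 * pi = p.*2.*2%:R * s.
  rewrite /s /grid_step -[in RHS]muln2 natrM; field.
  by rewrite pnatr_eq0 -lt0n double_gt0.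
move: s s0 => s s0; rewrite opprD addrACA subrr add0r -!mulrBl.
rewrite !normrM (gtr0_norm s0) !normr_natB.
have eE : Num.min ((nat_dist k k')%:R * s)
    (p.*2.*2%:R * s - (nat_dist k k')%:R * s) = e%:R * s.
  rewrite -mulrBl -natrB; last by rewrite /nat_dist; lia.
  by rewrite -minr_pMl ?ltW// -natr_min.
rewrite eE !exprMn -mulrDl sqrtrM ?addr_ge0 ?sqr_ge0//.
by rewrite sqrtr_sqr (gtr0_norm s0) mulrC.
Qed.

(** The whole form is a sum over pairs of circles; for each pair the rotation
    invariance leaves one alternating sum. *)
Lemma cylinder_form_grid (R : realType) (b z0 : R) (p M : nat) :
  (0 < p)%N ->
  \sum_(x : 'I_p.*2.*2 * 'I_M) \sum_(y : 'I_p.*2.*2 * 'I_M)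
    (-1) ^+ x.1 * (-1) ^+ y.1 *
    cylinder_dist (grid_point p z0 x.1 x.2) (grid_point p z0 y.1 y.2) `^ b =
  p.*2.*2%:R * grid_step R p `^ b *
    \sum_(l < M) \sum_(l' < M) axial_sum b p (nat_dist l l').
Proof.
move=> p0; have s0 := @grid_step_gt0 R p p0.
rewrite -(pair_bigA _ (fun (k : 'I_p.*2.*2) (l : 'I_M) =>
  \sum_(y : 'I_p.*2.*2 * 'I_M)
    (-1) ^+ k * (-1) ^+ y.1 *
    cylinder_dist (grid_point p z0 k l) (grid_point p z0 y.1 y.2) `^ b)) /=.
rewrite exchange_big /= mulr_sumr; apply: eq_bigr => l _.
under eq_bigr => k _.
  rewrite -(pair_bigA _ (fun (k' : 'I_p.*2.*2) (l' : 'I_M) =>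
    (-1) ^+ k * (-1) ^+ k' *
    cylinder_dist (grid_point p z0 k l) (grid_point p z0 k' l') `^ b)) /=.
  rewrite exchange_big /=.
  over.
rewrite exchange_big /= mulr_sumr; apply: eq_bigr => l' _.
rewrite /axial_sum -alternating_cycle_sum mulrAC.
pose f k := profile b (nat_dist l l')%:R k%:R.
rewrite -(alternating_cycle_form f) ?double_gt0 ?odd_double// mulr_suml.
apply: eq_bigr => k _; rewrite mulr_suml; apply: eq_bigr => k' _.
rewrite cylinder_dist_grid// -[RHS]mulrA; congr (_ * _).
rewrite powRM ?(ltW s0) ?sqrtr_ge0// mulrC; congr (_ * _).
rewrite /f /profile -powR12_sqrt ?addr_ge0 ?sqr_ge0//.
by rewrite -powRrM mulrC.
Qed.

Lemma grid_point_cylinder (R : realType) (eps h z0 : R) (p k l : nat) :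
  (0 < p)%N -> (k < p.*2.*2)%N -> 0 < z0 -> z0 + l%:R * grid_step R p <= h ->
  h < eps ->
  [/\ cylinder eps (grid_point p z0 k l), circle (grid_point p z0 k l).1 &
    0 < (grid_point p z0 k l).2 <= h].
Proof.
move=> p0 kN z00 zh he; have s0 := @grid_step_gt0 R p p0.
have c1 : circle (grid_point p z0 k l).1.
  rewrite /circle /= in_itv /= mulr_ge0 ?(ltW s0)//=.
  rewrite /grid_step mulrA ltr_pdivrMr ?ltr0n ?double_gt0//.
  rewrite [ltRHS]mulrAC ltr_pM2r ?pi_gt0//.
  by rewrite -natrM ltr_nat; lia.
have z0l : 0 < z0 + l%:R * grid_step R p.
  by rewrite ltr_wpDr// mulr_ge0// ltW.
split; [split | exact: c1 | by rewrite /= z0l]; first exact: c1.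
by rewrite /= in_itv /= z0l (le_lt_trans zh he).
Qed.

(** The grid is naturally indexed by a product of two finite types. *)
Lemma negative_definite_kernel_fin (R : realType) (T : Type) (S : set T)
    (f : T -> T -> R) (I : finType) (x : I -> T) (c : I -> R) :
  negative_definite_kernel S f -> (forall i, S (x i)) -> \sum_i c i = 0 ->
  \sum_i \sum_j c i * c j * f (x i) (x j) <= 0.
Proof.
move=> [_ nf] Sx c0.
have reindex (F : I -> R) : \sum_i F i = \sum_(i < #|I|) F (enum_val i).
  by rewrite (reindex (@enum_val I I))//; exact: onW_bij (enum_val_bij _).
have := nf #|I| (x \o enum_val) (c \o enum_val) (fun i => Sx _).
rewrite -(reindex c) => /(_ c0); rewrite reindex.
apply: le_trans; rewrite le_eqVlt; apply/orP; left; apply/eqP.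
by apply: eq_bigr => i _; rewrite reindex.
Qed.

Lemma sum_nat_dist_powRN_le (R : realType) (q : R) (M l : nat) :
  1 < q -> (l < M)%N ->
  \sum_(m < M) (nat_dist l m).+1%:R `^ (- q) <= 2 * (1 + (q - 1)^-1).
Proof.
move=> q1 lM.
rewrite -(big_mkord xpredT (fun m => (nat_dist l m).+1%:R `^ (- q))).
rewrite (big_cat_nat (n := l))//=; last exact: ltnW.
rewrite mulr_natl mulr2n; apply: lerD.
  apply: le_trans (sum_powRN_le l q1).
  rewrite big_nat_rev big_mkord; apply: ler_sum => m _.
  rewrite !powRN lef_pV2 ?posrE ?powR_gt0// ?ltr0n//.
  apply: ge0_ler_powR; rewrite ?nnegrE//; first by lra.
  by rewrite ler_nat /nat_dist; have := ltn_ord m; lia.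
apply: le_trans (sum_powRN_le (M - l) q1).
rewrite -{1}[l]add0n big_addn big_mkord; apply: ler_sum => m _.
have -> // : nat_dist l (m + l) = m by rewrite /nat_dist; lia.
Qed.

(** The positive contribution of the antipodes does not depend on the height
    offset, hence is quadratic in M, while the negative one decays summably in
    the offset, hence is linear in M. *)
Lemma sum_axial_sum_ge (R : realType) (b : R) : 0 < b < 1 ->
  exists2 K : R, 0 < K & forall p M : nat, (0 < p)%N -> (M <= p.*2)%N ->
    b / 10 * p.*2%:R `^ (b - 1) * M%:R ^+ 2 - K * M%:R <=
      \sum_(l < M) \sum_(m < M) axial_sum b p (nat_dist l m).
Proof.
move=> b01; set q := (3 - b) / 2; have q1 : 1 < q by rewrite /q; lra.
set C := 8 + 6 * (q - 1)^-1; set Z := 1 + (q - 1)^-1.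
have qV : 0 < (q - 1)^-1 by rewrite invr_gt0; lra.
have C0 : 0 < C by rewrite /C; lra.
have Z0 : 0 < Z by rewrite /Z; lra.
exists (C * (2 * Z)) => [|p M p0 Mp]; first by rewrite !mulr_gt0.
set A := b / 10 * p.*2%:R `^ (b - 1).
have -> : A * M%:R ^+ 2 - C * (2 * Z) * M%:R =
    \sum_(l < M) (A * M%:R - C * (2 * Z)).
  by rewrite sumr_const card_ord -mulr_natr; ring.
apply: ler_sum => l _.
apply: (@le_trans _ _ (\sum_(m < M) (A - C * (nat_dist l m).+1%:R `^ (- q)))).
  rewrite sumrB sumr_const card_ord mulr_natr lerD2l lerN2 -mulr_sumr.
  by rewrite ler_wpM2l ?(ltW C0)//; apply: sum_nat_dist_powRN_le.
apply: ler_sum => m _; apply: axial_sum_ge => //.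
by rewrite /nat_dist; have := ltn_ord l; have := ltn_ord m; lia.
Qed.

Lemma normr_le_Delta (R : realType) (d' : R * R -> R * R -> R) (h D : R)
    (x y : R * R) :
  (Delta d' h <= D%:E)%E -> circle x.1 -> circle y.1 ->
  0 < x.2 <= h -> 0 < y.2 <= h -> `|d' x y - cylinder_dist x y| <= D.
Proof.
case: x y => [t1 z1] [t2 z2] /= dD c1 c2 h1 h2.
rewrite -lee_fin; apply: le_trans dD; rewrite /Delta.
apply: (@le_trans _ _ (ereal_sup [set
  `|d' (t1, z1) (t2, z2) - cylinder_dist (t1, z1) (t2, z2)|%:E
    | t1 in @circle R & t2 in @circle R])).
  by apply: ereal_sup_ubound; exists t1 => //; exists t2.
apply: ereal_sup_ubound; exists z1; first by rewrite /= in_itv.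
by exists z2 => //; rewrite /= in_itv.
Qed.

(** The alternating coefficients sum to 0, so that the form of d' is
    nonpositive; the form of the cylinder distance exceeds it by at most B for
    each pair. *)
Lemma grid_form_le (R : realType) (eps h z0 b B : R)
    (d' : R * R -> R * R -> R) (p M : nat) :
  (0 < p)%N -> 0 < z0 -> h < eps ->
  (forall l : 'I_M, z0 + l%:R * grid_step R p <= h) ->
  negative_definite_kernel (cylinder eps) (fun x y => d' x y `^ b) ->
  (forall (k k' : 'I_p.*2.*2) (l l' : 'I_M),
    let x := grid_point p z0 k l in let y := grid_point p z0 k' l' in
    `|d' x y `^ b - cylinder_dist x y `^ b| <= B) ->
  grid_step R p `^ b *
    (\sum_(l < M) \sum_(l' < M) axial_sum b p (nat_dist l l')) <=
    p.*2.*2%:R * M%:R ^+ 2 * B.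
Proof.
move=> p0 z00 he zh ndk dB.
have N0 : 0 < p.*2.*2%:R :> R by rewrite ltr0n !double_gt0.
rewrite -(ler_pM2l N0) mulrA -(@cylinder_form_grid R b z0 p M p0).
pose I := ('I_p.*2.*2 * 'I_M)%type.
pose X (i : I) := grid_point p z0 i.1 i.2.
pose c (i : I) : R := (-1) ^+ i.1.
have c0 : \sum_i c i = 0.
  rewrite -(pair_bigA _ (fun (k : 'I_p.*2.*2) (l : 'I_M) => (-1) ^+ k)) /=.
  rewrite exchange_big /= big1// => l _.
  rewrite -(big_mkord xpredT (fun k => (-1) ^+ k : R)).
  elim: p.*2 => [|m IH]; first by rewrite big_geq.
  by rewrite doubleS !big_nat_recr//= IH exprS; ring.
have XS i : cylinder eps (X i).
  by have [] := grid_point_cylinder p0 (ltn_ord i.1) z00 (zh i.2) he.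
have /= neg := negative_definite_kernel_fin ndk XS c0.
rewrite -[leRHS]add0r -lerBlDr; apply: le_trans neg.
rewrite lerBlDr -lerBlDl -sumrB.
apply: (@le_trans _ _ (\sum_(i : I) \sum_(j : I) B)).
  apply: ler_sum => i _; rewrite -sumrB; apply: ler_sum => j _.
  rewrite -/(X i) -/(X j) -/(c i) -/(c j) -mulrBr (le_trans (ler_norm _))//.
  rewrite !normrM !normrX normrN1 !expr1n !mul1r distrC.
  exact: dB.
rewrite !sumr_const !card_prod !card_ord -mulrnA -[leLHS]mulr_natr !natrM.
by rewrite le_eqVlt; apply/orP; left; apply/eqP; ring.
Qed.

(** Distinct grid points are at distance at least the spacing s, so that the
    map x |-> x ^ b has there the Lipschitz constant s ^ (b - 1); on the
    diagonal both distances vanish. After division by s ^ (b - 1) only a factor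
    s remains on the left. *)
Lemma grid_form_lt1_le (R : realType) (eps b D : R)
    (d' : R * R -> R * R -> R) (p M : nat) :
  (0 < p)%N -> (0 < M)%N -> 0 < b < 1 -> distance_on (cylinder eps) d' ->
  negative_definite_kernel (cylinder eps) (fun x y => d' x y `^ b) ->
  M%:R * grid_step R p < eps ->
  (Delta d' (M%:R * grid_step R p) <= D%:E)%E ->
  grid_step R p * (\sum_(l < M) \sum_(l' < M) axial_sum b p (nat_dist l l'))
    <= p.*2.*2%:R * M%:R ^+ 2 * D.
Proof.
move=> p0 M0 /andP[b0 b1] [d0 dE _ _] ndk he dD.
have s0 := @grid_step_gt0 R p p0; set s := grid_step R p in s0 he dD *.
have zh (l : 'I_M) : s + l%:R * s <= M%:R * s.
  by rewrite -{1}[s]mul1r -mulrDl ler_pM2r// addrC natr1 ler_nat.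
have grid (k : 'I_p.*2.*2) (l : 'I_M) :=
  @grid_point_cylinder R eps _ s p k l p0 (ltn_ord _) s0 (zh l) he.
have near (k k' : 'I_p.*2.*2) (l l' : 'I_M) :
    `|d' (grid_point p s k l) (grid_point p s k' l')
      - cylinder_dist (grid_point p s k l) (grid_point p s k' l')| <= D.
  have [_ c1 h1] := grid k l; have [_ c2 h2] := grid k' l'.
  exact: normr_le_Delta dD c1 c2 h1 h2.
have D0 : 0 <= D.
  have k0 : 'I_p.*2.*2 by exists 0%N; rewrite !double_gt0.
  have l0 : 'I_M by exists 0%N.
  by apply: le_trans (near k0 k0 l0 l0).
have B0 : 0 <= s `^ (b - 1) * D by rewrite mulr_ge0// powR_ge0.
have key := @grid_form_le R eps (M%:R * s) s b (s `^ (b - 1) * D) d' p M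
  p0 s0 he zh ndk.
have {}key := key _.
have sb : s `^ b = s * s `^ (b - 1) by rewrite mulr_powRB1// ltW.
have sb0 : 0 < s `^ (b - 1) by rewrite powR_gt0.
rewrite -(ler_pM2l sb0) mulrA [_ * s]mulrC -sb.
apply: le_trans (key _) _; last by rewrite mulrCA.
move=> k k' l l'; set x := grid_point p s k l; set y := grid_point p s k' l'.
cbv zeta.
(* The Lipschitz bound does not apply to pairs of equal points. *)
have [/andP[/eqP kk /eqP ll]|kl] := boolP ((k == k') && (l == l')).
  have [cx _ _] := grid k l; have [cy _ _] := grid k' l'.
  have dxx : d' x y = 0 by apply/(dE x y cx cy); rewrite /x /y kk ll.
  have cxx : cylinder_dist x y = 0.
    by rewrite cylinder_dist_grid// kk ll /nat_dist !maxnn !minnn !subnn min0n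
      expr0n /= addr0 sqrtr0 mulr0.
  by rewrite dxx cxx subrr normr0.
have sd : s <= cylinder_dist x y.
  rewrite cylinder_dist_grid// -[leLHS]mulr1 ler_pM2l//.
  rewrite -[leLHS]sqrtr1 ler_wsqrtr// -!natrX -natrD ler1n.
  rewrite addn_gt0 !expn_gt0 !orbF; have := ltn_ord k; have := ltn_ord k'.
  move: kl; rewrite -!val_eqE /= /nat_dist; lia.
apply: le_trans (powR_lipschitz s0 sd _ _) _.
- by apply: d0; [have [] := grid k l|have [] := grid k' l'].
- by rewrite b0 ltW.
- by rewrite ler_pM2l//; apply: near.
Qed.

(** * Exponents excluded by the grids *)

Lemma powR_nat_unbounded (R : realType) (a K : R) :
  0 < a -> exists n0 : nat, forall n : nat, (n0 <= n)%N -> K < n%:R `^ a.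
Proof.
move=> a0; pose y := (`|K| + 1) `^ a^-1.
have K1 : 0 < `|K| + 1 by rewrite ltr_wpDl.
exists (Num.truncn y).+1 => n nn; apply: (@lt_le_trans _ _ (`|K| + 1)).
  by rewrite (le_lt_trans (ler_norm K))// ltrDl.
have <- : y `^ a = `|K| + 1 by rewrite -powRrM mulVf ?gt_eqF// powRr1// ltW.
apply: ge0_ler_powR; rewrite ?nnegrE ?powR_ge0 ?(ltW a0)//.
apply: (@le_trans _ _ (Num.truncn y).+1%:R); last by rewrite ler_nat.
by apply/ltW/truncnS_gt.
Qed.

Lemma Delta_bigO_right (R : realType) (d' : R * R -> R * R -> R) (delta : R) :
  Delta_bigO d' delta ->
  exists C e : R, 0 < e /\
    forall h, 0 < h < e -> (Delta d' h <= (C * h `^ delta)%:E)%E.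
Proof.
move=> [C] /nbhs_ballP[e /= e0 He]; exists C, e; split => // h /andP[h0 he].
by apply: He => //=; rewrite /ball /= sub0r normrN gtr0_norm.
Qed.

(** If b (1 + delta) > 3, a fine enough grid contradicts the bound of
    [grid_form_lt1_le]. *)
Lemma index_lt1_le (R : realType) (eps delta b : R)
    (d' : R * R -> R * R -> R) :
  0 < eps -> 0 < delta -> 0 < b < 1 -> distance_on (cylinder eps) d' ->
  Delta_bigO d' delta ->
  negative_definite_kernel (cylinder eps) (fun x y => d' x y `^ b) ->
  b * (1 + delta) <= 3.
Proof.
move=> eps0 delta0 b01 dd /Delta_bigO_right[C [e [e0 He]]] ndk.
have /andP[b0 b1] := b01.
rewrite leNgt; apply/negP => b3.
set a := b * (1 + delta) - 3; have a0 : 0 < a by rewrite /a subr_gt0.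
have [K K0 HK] := sum_axial_sum_ge b01.
(* M is at least L n ^ (1 - b), so that the linear term K M is at most half of
   the quadratic term (b / 10) n ^ (b - 1) M ^ 2. *)
pose L := 20 * K / b.
have L0 : 0 < L by rewrite divr_gt0// mulr_gt0.
pose eta := Num.min eps e; have eta0 : 0 < eta by rewrite lt_min eps0.
have [n1 Hn1] := powR_nat_unbounded (Num.max (L + 1) ((L + 1) * pi / eta)) b0.
(* The grid of size n gives the reverse of the inequality Hn2. *)
have [n2 Hn2] :=
  powR_nat_unbounded (40 * (`|C| * ((L + 1) * pi) `^ delta) / (b * pi)) a0.
pose p := (maxn n1 n2).+1; pose n := p.*2.
have p0 : (0 < p)%N by [].
have mn : (maxn n1 n2 <= n)%N.
  by rewrite /n -addnn (leq_trans (leqnSn _))// leq_addr.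
have {}Hn1 := Hn1 n (leq_trans (leq_maxl _ _) mn).
have {}Hn2 := Hn2 n (leq_trans (leq_maxr _ _) mn).
have x1 : 1 <= n%:R :> R by rewrite ler1n.
set x : R := n%:R in Hn1 Hn2 x1.
have x0 : 0 < x by apply: lt_le_trans x1.
have xne : x != 0 by rewrite gt_eqF.
move: Hn1; rewrite gt_max => /andP[xL xeta].
have u0 : 0 < x `^ b by rewrite powR_gt0.
have v0 : 0 < x `^ (1 - b) by rewrite powR_gt0.
have vE : x `^ (1 - b) = x / x `^ b.
  by rewrite powRB ?xne ?implybT// powRr1 ?ltW.
have wE : x `^ (b - 1) = x `^ b / x.
  by rewrite powRB ?xne ?implybT// powRr1 ?ltW.
have v1 : 1 <= x `^ (1 - b) by rewrite -[leLHS](powRr0 x) ler_powR//; lra.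
pose M := (Num.truncn (L * x `^ (1 - b))).+1.
have ML : L * x `^ (1 - b) <= M%:R by apply/ltW/truncnS_gt.
have MU : M%:R <= (L + 1) * x `^ (1 - b).
  rewrite /M -natr1 mulrDl mul1r lerD// truncn_le// mulr_ge0 ?ltW//.
have Mn : (M <= n)%N.
  rewrite -(ler_nat R) (le_trans MU)// -/x vE mulrA ler_pdivrMr// mulrC.
  by rewrite ler_pM2l// ltW.
have M0 : 0 < M%:R :> R by rewrite ltr0n.
set s := grid_step R p.
have sE : s = pi / x by [].
have s0 : 0 < s by apply: grid_step_gt0.
have pi0 : 0 < pi :> R by apply: pi_gt0.
have hU : M%:R * s <= (L + 1) * pi / x `^ b.
  apply: (le_trans (ler_wpM2r (ltW s0) MU)).
  rewrite vE sE le_eqVlt; apply/orP; left; apply/eqP.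
  by field; rewrite xne gt_eqF.
have heta : M%:R * s < eta.
  by rewrite (le_lt_trans hU)// ltr_pdivrMr// [ltRHS]mulrC -ltr_pdivrMr.
have h0 : 0 < M%:R * s by rewrite mulr_gt0.
move: heta; rewrite lt_min => /andP[heps he].
have := @grid_form_lt1_le R eps b (C * (M%:R * s) `^ delta) d' p M p0 isT b01 dd
  ndk heps.
rewrite -/s He ?h0// => /(_ isT).
have := HK p M p0 Mn.
set S := \sum_(l < M) _ => SL SU.
have KM : K * M%:R <= b / 20 * x `^ (b - 1) * M%:R ^+ 2.
  rewrite expr2 mulrA ler_pM2r//.
  apply: le_trans (ler_wpM2l _ ML); last by rewrite mulr_ge0 ?powR_ge0//; lra.
  by rewrite wE vE /L le_eqVlt; apply/orP; left; apply/eqP; field;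
    rewrite xne !gt_eqF.
have {}SL : b / 20 * x `^ (b - 1) * M%:R ^+ 2 <= S.
  by move: SL; rewrite -/n -/x; lra.
have D1 : C * (M%:R * s) `^ delta <=
    `|C| * ((L + 1) * pi) `^ delta / x `^ (b * delta).
  have -> : `|C| * ((L + 1) * pi) `^ delta / x `^ (b * delta) =
      `|C| * ((L + 1) * pi / x `^ b) `^ delta.
    rewrite [in RHS]powRM ?invr_ge0 ?(ltW u0) ?mulr_ge0 ?(ltW pi0)//;
      last by lra.
    by rewrite -(powRN x b) -powRrM mulNr powRN mulrA.
  apply: (le_trans (ler_wpM2r (powR_ge0 _ _) (ler_norm C))).
  apply: ler_wpM2l => //; apply: ge0_ler_powR; rewrite ?nnegrE ?(ltW h0)//.
    exact: ltW.
  by rewrite divr_ge0 ?(ltW u0)// mulr_ge0 ?(ltW pi0)//; lra.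
set W := `|C| * _ in Hn2 D1.
have z0 : 0 < x `^ (b * delta) by rewrite powR_gt0.
have M20 : 0 < M%:R ^+ 2 :> R by rewrite exprn_gt0.
have NE : p.*2.*2%:R = 2 * x by rewrite -muln2 natrM mulrC.
have aE : x `^ a = x `^ b * x `^ (b * delta) / x ^+ 3.
  rewrite /a powRB ?xne ?implybT// mulrDr mulr1 powRD ?xne ?implybT//.
  by rewrite powR_mulrn// ltW.
move: Hn2; rewrite ltNge => /negP; apply.
rewrite aE ler_pdivlMr ?mulr_gt0// mulrAC ler_pdivrMr ?exprn_gt0//.
have F : pi / x * (b / 20 * (x `^ b / x)) <= 2 * x * (W / x `^ (b * delta)).
  rewrite -(ler_pM2r M20) -wE -sE -[leLHS]mulrA.
  apply: (le_trans (ler_wpM2l (ltW s0) SL)); apply: (le_trans SU).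
  rewrite NE mulrAC ler_pM2r//; apply: ler_wpM2l => //.
  by rewrite mulr_ge0// ltW.
have m0 : 0 < 20 * x ^+ 2 * x `^ (b * delta) by rewrite !mulr_gt0// exprn_gt0.
move: F; rewrite -(ler_pM2l m0).
have -> : 20 * x ^+ 2 * x `^ (b * delta) * (pi / x * (b / 20 * (x `^ b / x)))
    = x `^ b * x `^ (b * delta) * (b * pi) by field.
have -> // : 20 * x ^+ 2 * x `^ (b * delta) * (2 * x * (W / x `^ (b * delta)))
    = 40 * W * x ^+ 3 by field; rewrite gt_eqF.
Qed.

Lemma powR_continuous_pos (R : realType) (b v : R) :
  0 < v -> {for v, continuous (fun x => x `^ b)}.
Proof.
move=> v0; apply: differentiable_continuous; apply/derivable1_diffP.
by have [] := @is_derive1_powR R b v v0.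
Qed.

(** The b-th power of the distance of the circle is not negative definite for
    b > 1: four equidistant points with alternating signs give a multiple of
    2 ^ b - 2 > 0, a value that does not depend on the height and therefore is
    approached by the form of d' as the height tends to 0. *)
Lemma index_gt1_false (R : realType) (eps delta b : R)
    (d' : R * R -> R * R -> R) :
  0 < eps -> 0 < delta -> 1 < b -> distance_on (cylinder eps) d' ->
  Delta_bigO d' delta ->
  ~ negative_definite_kernel (cylinder eps) (fun x y => d' x y `^ b).
Proof.
move=> eps0 delta0 b1 [d0 dE _ _] /Delta_bigO_right[C [e [e0 He]]] ndk.
pose s := grid_step R 1; have s0 : 0 < s by apply: grid_step_gt0.
have b0 : 0 < b by lra.
have sb0 : 0 < s `^ b by rewrite powR_gt0.
have b2 : 2 < 2 `^ b.
  have b10 : 0 <= b - 1 by lra.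
  have := powR_ge1BV (ltr0n R 2) b10; rewrite -(mulr_powRB1 (ler0n R 2) b0).
  by move: (2 `^ (b - 1)) => t; lra.
pose B := s `^ b * (2 `^ b - 2) / 8.
have B0 : 0 < B by rewrite divr_gt0// mulr_gt0//; lra.
pose gap z0 k k' := `|d' (grid_point 1 z0 k 0) (grid_point 1 z0 k' 0) `^ b
  - cylinder_dist (grid_point 1 z0 k 0) (grid_point 1 z0 k' 0) `^ b|.
have close (k k' : 'I_4) : \forall z0 \near (0 : R)^'+, gap z0 k k' <= B.
  have inS z0 (l : 'I_4) : 0 < z0 -> z0 < eps ->
      [/\ cylinder eps (grid_point 1 z0 l 0),
          circle (grid_point 1 z0 l 0).1 & 0 < (grid_point 1 z0 l 0).2 <= z0].
    move=> z00 z0e; apply: grid_point_cylinder => //.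
    by rewrite mul0r addr0.
  (* The power is continuous at the positive limit of the distance; on the
     diagonal both distances vanish. *)
  have [kk|kk] := eqVneq k k'.
    near=> z0.
    have z00 : 0 < z0 by near: z0; exact: nbhs_right_gt.
    have z0e : z0 < eps by near: z0; exact: nbhs_right_lt.
    have [cx _ _] := inS z0 k z00 z0e; rewrite /gap.
    have [cy _ _] := inS z0 k' z00 z0e.
    have -> : d' (grid_point 1 z0 k 0) (grid_point 1 z0 k' 0) = 0.
      by apply/(dE _ _ cx cy); rewrite kk.
    rewrite cylinder_dist_grid// kk /nat_dist !maxnn !minnn !subnn min0n.
    by rewrite expr0n /= addr0 sqrtr0 mulr0 subrr normr0 ltW.
  pose v := s * Num.sqrt ((minn (nat_dist k k') (4 - nat_dist k k'))%:R ^+ 2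
    + (nat_dist 0 0)%:R ^+ 2).
  have v0 : 0 < v.
    rewrite mulr_gt0// sqrtr_gt0 ltr_wpDr ?sqr_ge0// exprn_gt0// ltr0n.
    have := ltn_ord k; have := ltn_ord k'; move: kk; rewrite -val_eqE /=.
    by rewrite /nat_dist; lia.
  have /cvgr_dist_le/(_ B B0) := @powR_continuous_pos R b v v0.
  move=> /nbhs_ballP[r /= r0 Hr].
  near=> z0.
  have z00 : 0 < z0 by near: z0; exact: nbhs_right_gt.
  have z0e : z0 < eps by near: z0; exact: nbhs_right_lt.
  have z0e' : z0 < e by near: z0; exact: nbhs_right_lt.
  have [cx x1 x2] := inS z0 k z00 z0e; have [cy y1 y2] := inS z0 k' z00 z0e.
  have vE : cylinder_dist (grid_point 1 z0 k 0) (grid_point 1 z0 k' 0) = v.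
    exact: cylinder_dist_grid.
  have dD : (Delta d' z0 <= (C * z0 `^ delta)%:E)%E by apply: He; rewrite z00.
  have := normr_le_Delta dD x1 y1 x2 y2; rewrite vE => dv.
  rewrite /gap vE distrC; apply: Hr; rewrite /ball /= distrC (le_lt_trans dv)//.
  apply: (@le_lt_trans _ _ ((`|C| + 1) * z0 `^ delta)).
    by rewrite ler_wpM2r ?powR_ge0// (le_trans (ler_norm C))// lerDl.
  have C1 : 0 < `|C| + 1 by rewrite ltr_wpDl.
  rewrite mulrC -ltr_pdivlMr//.
  rewrite (le_lt_trans (ler_norm _))//.
  near: z0; apply: cvgr0_norm_lt; first exact: powR_cvg0.
  by rewrite divr_gt0.
have [z0 [z00 z0e Hz]] : exists z0 : R,
    [/\ 0 < z0, z0 < eps & forall k k' : 'I_4, gap z0 k k' <= B].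
  have : \forall z0 \near (0 : R)^'+,
      [/\ 0 < z0, z0 < eps & forall k k' : 'I_4, gap z0 k k' <= B].
    near=> z0; split.
    - by near: z0; exact: nbhs_right_gt.
    - by near: z0; exact: nbhs_right_lt.
    - near: z0; apply: filter_forall => k; apply: filter_forall => k'.
      exact: close.
  by move=> /filter_ex[z0 ?]; exists z0.
have z0h (l : 'I_1) : z0 + l%:R * grid_step R 1 <= z0.
  by rewrite ord1 mul0r addr0.
have := @grid_form_le R eps z0 z0 b B d' 1 1 isT z00 z0e z0h ndk.
have Hz' (k k' : 'I_4) (l l' : 'I_1) :
    `|d' (grid_point 1 z0 k l) (grid_point 1 z0 k' l') `^ b
      - cylinder_dist (grid_point 1 z0 k l) (grid_point 1 z0 k' l') `^ b| <= B.
  by rewrite !ord1; apply: Hz.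
move=> /(_ Hz').
have -> : \sum_(l < 1) \sum_(l' < 1) axial_sum b 1 (nat_dist l l')
    = 2 `^ b - 2 :> R.
  rewrite !big_ord1 /axial_sum big_ord1 /second_difference /profile.
  rewrite /nat_dist maxnn minnn subnn double0 expr0n /= !addr0.
  rewrite powR0 ?expr1n ?powR1; last by rewrite gt_eqF// divr_gt0.
  have -> : (2 ^+ 2) `^ (b / 2) = 2 `^ b :> R.
    by rewrite -powR_mulrn// -powRrM; congr (_ `^ _); field.
  by rewrite sub0r mulr1 addrC.
have -> : s `^ b * (2 `^ b - 2) = 8 * B by rewrite /B; field.
have -> : 1.*2.*2%:R = 4 :> R by [].
by rewrite expr1n; lra.
Unshelve. all: by end_near.
Qed.

(** If beta exceeded 3 / (delta + 1), so would some exponent b <= beta that is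
    either larger than 1 or, after averaging with 3 / (delta + 1), below 1. *)
Lemma fractional_index_le (R : realType) (eps delta : R)
    (d' : R * R -> R * R -> R) (beta : \bar R) :
  0 < eps -> distance_on (cylinder eps) d' ->
  is_fractional_index (cylinder eps) d' beta ->
  0 < delta -> Delta_bigO d' delta -> (beta <= (3 / (delta + 1))%:E)%E.
Proof.
move=> eps0 dd [_ ib] delta0 dO; rewrite leNgt; apply/negP => lt_beta.
have D0 : 0 < delta + 1 by lra.
set r := 3 / (delta + 1) in lt_beta; have r0 : 0 < r by rewrite divr_gt0.
have ndk (b : R) : 0 < b -> (b%:E <= beta)%E ->
    negative_definite_kernel (cylinder eps) (fun x y => d' x y `^ b).
  move=> b0 bbeta; have b20 : 0 < b / 2 by lra.
  have := (ib (b / 2) b20).2; have -> : 2 * (b / 2) = b by field.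
  exact.
have [b rb bbeta] : exists2 b : R, r < b & (b%:E <= beta)%E.
  case: beta lt_beta {ib ndk} => [x||//]; first by rewrite lte_fin; exists x.
  by exists (r + 1); [lra|rewrite leey].
have [b_gt1|b_le1] := ltP 1 b.
  apply: (index_gt1_false eps0 delta0 b_gt1 dd dO); apply: ndk => //; lra.
pose b' := (b + r) / 2.
have b'01 : 0 < b' < 1 by rewrite /b'; apply/andP; split; lra.
have b'beta : (b'%:E <= beta)%E.
  by apply: le_trans bbeta; rewrite lee_fin /b'; lra.
have := index_lt1_le eps0 delta0 b'01 dd dO (ndk b' _ b'beta).
have /andP[b'0 _] := b'01; move=> /(_ b'0).
have : r < b' by rewrite /b'; lra.
by rewrite /r ltr_pdivrMr// [1 + _]addrC => /lt_le_trans h /h; rewrite ltxx.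
Qed.

Theorem theorem3 (R : realType) (eps : R) (d' : R * R -> R * R -> R)
    (beta : \bar R) :
  0 < eps ->
  distance_on (cylinder eps) d' ->
  is_fractional_index (cylinder eps) d' beta ->
  (forall delta : R, delta_exponent d' = delta%:E ->
     (beta <= (3 / (delta + 1))%:E)%E) /\
  (delta_exponent d' = +oo%E -> beta = 0%E).
Proof.
move=> eps0 dd ib.
have bound := fractional_index_le eps0 dd ib; have [beta0 _] := ib.
set A := [set delta : R | 0 < delta /\ Delta_bigO d' delta].
have witness : (-oo < delta_exponent d')%E -> exists a, A a.
  move=> /ereal_sup_gt[_ [a Aa _] _]; by exists a.
have [beta_pos|beta_le0] := ltP 0%E beta; last first.
  have -> : beta = 0%E by apply/eqP; rewrite eq_le beta_le0.
  split=> // delta dE; rewrite lee_fin divr_ge0//.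
  have [|a [a0 aO]] := witness; first by rewrite dE ltNyr.
  have : (a%:E <= delta_exponent d')%E by apply: ereal_sup_ubound; exists a.
  by rewrite dE lee_fin; lra.
have sup_le a : A a -> exists2 r : R, beta = r%:E & a <= 3 / r - 1.
  move=> [a0 aO]; have := bound a a0 aO.
  case: beta beta_pos {ib bound beta0} => // r; rewrite lte_fin lee_fin => r0.
  rewrite ler_pdivlMr; last by lra.
  move=> ra; exists r => //; rewrite lerBrDr ler_pdivlMr//; lra.
split=> [delta dE|dE]; last first.
  have [|a Aa] := witness; first by rewrite dE.
  have [r br _] := sup_le a Aa.
  suff : (delta_exponent d' <= (3 / r - 1)%:E)%E by rewrite dE.
  apply: ge_ereal_sup => _ [c Ac <-]; have [r'] := sup_le c Ac.
  by rewrite br => -[<-]; rewrite lee_fin.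
have [|a Aa] := witness; first by rewrite dE ltNyr.
have [r br ar] := sup_le a Aa.
have : (delta_exponent d' <= (3 / r - 1)%:E)%E.
  apply: ge_ereal_sup => _ [c Ac <-]; have [r'] := sup_le c Ac.
  by rewrite br => -[<-]; rewrite lee_fin.
rewrite dE lee_fin => dr.
have ad : a <= delta.
  have : (a%:E <= delta_exponent d')%E by apply: ereal_sup_ubound; exists a.
  by rewrite dE lee_fin.
move: beta_pos; rewrite br lte_fin lee_fin => r0; have [a0 _] := Aa.
rewrite ler_pdivlMr; last by lra.
by move: dr; rewrite lerBrDr ler_pdivlMr// mulrC.
Qed.
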